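(* Let $(\mathfrak g,\mathfrak h,\kappa)$ be a split quadratic Lie algebra over a field $\mathbb K$ of characteristic zero such that $\kappa(\check\alpha,\check\alpha)\in\mathbb Q$ for all $\alpha\in\Delta_i$ and $\Delta\subseteq \operatorname{span}_{\mathbb Z}\Delta_i$. Then each integral weight $\lambda\in\mathfrak h^*$ defines a $\mathbb Q$-grading of the Lie algebra $\mathfrak g$ by $$\mathfrak g^q:=\mathfrak g^q(\lambda):=\bigoplus_{\alpha\in\Delta\cup\{0\},\ \lambda(\alpha^\sharp)=q}\mathfrak g_\alpha\qquad (q\in\mathbb Q).$$ If, in addition, $\beta(\check\alpha)\,\alpha(\check\beta)\le 4$ holds for all $\alpha,\beta\in\Delta_i$ and $\Delta_i$ is connected, then the support $\{q\in\mathbb Q:\mathfrak g^q\neq\{0\}\}$ of this grading lies in a cyclic subgroup of $\mathbb Q$, so that one actually obtains a $\mathbb Z$-grading.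
   Context: $\mathbb K$ is a field of characteristic zero. A split Lie algebra is a pair $(\mathfrak g,\mathfrak h)$ where $\mathfrak h$ is a maximal abelian subalgebra of the $\mathbb K$-Lie algebra $\mathfrak g$ with $\operatorname{ad}\mathfrak h$ simultaneously diagonalizable. Put $\mathfrak g_\alpha=\{x\in\mathfrak g:[h,x]=\alpha(h)x\ \forall h\in\mathfrak h\}$, so $\mathfrak g_0=\mathfrak h$, and $\Delta=\{\alpha\in\mathfrak h^*\setminus\{0\}:\mathfrak g_\alpha\ne\{0\}\}$. A root $\alpha\in\Delta$ is integrable if there exist $x_{\pm\alpha}\in\mathfrak g_{\pm\alpha}$ with $\alpha([x_\alpha,x_{-\alpha}])\neq0$ such that $\operatorname{ad}x_{\pm\alpha}$ are locally nilpotent on $\mathfrak g$; then $\dim\mathfrak g_{\pm\alpha}=1$ and the coroot $\check\alpha$ is the unique element of $[\mathfrak g_\alpha,\mathfrak g_{-\alpha}]$ with $\alpha(\check\alpha)=2$. $\Delta_i$ is the set of integrable roots. $\Delta_i$ is connected if for all $\alpha,\beta\in\Delta_i$ there is a chain $\alpha=\alpha_0,\dots,\alpha_n=\beta$ in $\Delta_i$ with $\alpha_{j+1}(\check\alpha_j)\ne0$ for all $j$. A functional $\lambda\in\mathfrak h^*$ is an integral weight if $\lambda(\check\alpha)\in\mathbb Z$ for all $\alpha\in\Delta_i$. A split quadratic Lie algebra $(\mathfrak g,\mathfrak h,\kappa)$ is a split Lie algebra with a non-degenerate invariant symmetric bilinear form $\kappa$. Then $\kappa|_{\mathfrak h\times\mathfrak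 h}$ is non-degenerate, the map $\flat:\mathfrak h\to\mathfrak h^*$, $h^\flat(x)=\kappa(x,h)$, is injective, and $\Delta\subseteq\mathfrak h^\flat:=\flat(\mathfrak h)$; for $\alpha\in\mathfrak h^\flat$ one puts $\alpha^\sharp:=\flat^{-1}(\alpha)\in\mathfrak h$. *)

(* Defs.v *)
From HB Require Import structures.
From mathcomp Require Import all_boot all_order all_algebra.
From mathcomp Require Import boolp classical_sets.

Set Implicit Arguments.
Unset Strict Implicit.
Unset Printing Implicit Defensive.

Import Order.TTheory GRing.Theory Num.Theory.
Local Open Scope ring_scope.
Local Open Scope classical_set_scope.

HB.mixin Record Lmodule_isLie (K : fieldType) g of GRing.Lmodule K g := {
  lie_bracket : g -> g -> g;
  lie_bracketPl : forall (c : K) (x y z : g),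
    lie_bracket (c *: x + y) z = c *: lie_bracket x z + lie_bracket y z;
  lie_bracketPr : forall (c : K) (x y z : g),
    lie_bracket z (c *: x + y) = c *: lie_bracket z x + lie_bracket z y;
  lie_bracketxx : forall x : g, lie_bracket x x = 0;
  lie_jacobi : forall x y z : g,
    lie_bracket x (lie_bracket y z) + lie_bracket y (lie_bracket z x)
      + lie_bracket z (lie_bracket x y) = 0
}.

#[short(type="lieType")]
HB.structure Definition LieAlgebra (K : fieldType) :=
  {g of Lmodule_isLie K g & GRing.Lmodule K g}.

Notation "[ 'lie' x , y ]" := (lie_bracket x y)
  (at level 0, format "[ 'lie'  x ,  y ]") : ring_scope.

Section VectorSpaces.
Context {K : fieldType} {V : lmodType K}.

(* A Hamel basis, V being possibly of infinite dimension. *)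
Definition is_basis (B : set V) : Prop :=
  (forall (n : nat) (b : 'I_n -> V) (c : 'I_n -> K),
     injective b -> (forall k, B (b k)) ->
     \sum_(k < n) c k *: b k = 0 -> forall k, c k = 0) /\
  (forall v : V, exists (n : nat) (b : 'I_n -> V) (c : 'I_n -> K),
     (forall k, B (b k)) /\ v = \sum_(k < n) c k *: b k).

(* The (not necessarily direct) sum of the subspaces F i, for i in D. *)
Definition sum_of (I : Type) (D : set I) (F : I -> set V) : set V :=
  [set v | exists (n : nat) (i : 'I_n -> I) (x : 'I_n -> V),
     (forall k, D (i k) /\ F (i k) (x k)) /\ v = \sum_(k < n) x k].

(* The sum of the subspaces F i, for i in D, is direct. *)
Definition independent (I : Type) (D : set I) (F : I -> set V) : Prop :=
  forall (n : nat) (i : 'I_n -> I) (x : 'I_n -> V),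
    injective i -> (forall k, D (i k) /\ F (i k) (x k)) ->
    \sum_(k < n) x k = 0 -> forall k, x k = 0.

End VectorSpaces.

Section LieAlgebras.
Context {K : fieldType} {g : lieType K}.

(* Closure under the bracket is automatic, the bracket being zero on a. *)
Definition abelian_subalgebra (a : {pred g}) : Prop :=
  submod_closed a /\ {in a &, forall x y, [lie x, y] = 0}.

Definition maximal_abelian_subalgebra (a : {pred g}) : Prop :=
  abelian_subalgebra a /\
  forall b : {pred g},
    abelian_subalgebra b -> {subset a <= b} -> {subset b <= a}.

Definition lie_span (A B : set g) : set g :=
  [set v | exists (n : nat) (x y : 'I_n -> g),
     (forall k, A (x k) /\ B (y k)) /\ v = \sum_(k < n) [lie x k, y k]].

Definition ad_locally_nilpotent (x : g) : Prop :=
  forall y : g, exists n : nat, iter n (fun z => [lie x, z]) y = 0.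

Definition is_grading (I : zmodType) (G : I -> set g) : Prop :=
  [/\ forall i, submod_closed [in G i],
      independent setT G,
      sum_of setT G = setT &
      forall i j x y, G i x -> G j y -> G (i + j) [lie x, y]].

(* K-bilinearity and symmetry are part of {symmetric g}. *)
Definition invariant_nondegenerate (kappa : {symmetric g}) : Prop :=
  (forall x y z : g, kappa [lie x, y] z = kappa x [lie y, z]) /\
  (forall x : g, (forall y : g, kappa x y = 0) -> x = 0).

End LieAlgebras.

(* The subspace S of g is also given as a type h with its linear inclusion     *)
(* \val : h -> g, so that the dual space of S is the type {scalar h}.          *)
Section SplitLieAlgebras.
Context {K : fieldType} {g : lieType K} {S : {pred g}} {h : subLmodType S}.

Definition rootspace (alpha : h -> K) : set g :=
  [set x | forall t : h, [lie \val t, x] = alpha t *: x].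

Definition is_root (alpha : {scalar h}) : Prop :=
  ~ (alpha =1 \0) /\ exists x : g, rootspace alpha x /\ x != 0.

(* t is the element [x, y] seen in h; it exists as [x, y] lies in g_0.         *)
Definition integrable_root (alpha : {scalar h}) : Prop :=
  is_root alpha /\
  exists (x y : g) (t : h),
    [/\ rootspace alpha x, rootspace (fun s => - alpha s) y,
        \val t = [lie x, y] & alpha t != 0] /\
    (ad_locally_nilpotent x /\ ad_locally_nilpotent y).

(* The element t of [g_alpha, g_(-alpha)] with alpha(t) = 2; it exists and is  *)
(* unique if alpha is an integrable root of a split Lie algebra.               *)
Definition coroot (alpha : {scalar h}) : h :=
  xget 0 [set t : h |
    lie_span (rootspace alpha) (rootspace (fun s => - alpha s)) (\val t) /\
    alpha t = 2].

Definition integrable_connected (alpha beta : {scalar h}) : Prop :=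
  exists (n : nat) (c : nat -> {scalar h}),
    [/\ c 0 = alpha, c n = beta,
        forall j, (j <= n)%N -> integrable_root (c j) &
        forall j, (j < n)%N -> c j.+1 (coroot (c j)) != 0].

Definition in_Zspan_integrable (alpha : {scalar h}) : Prop :=
  exists (n : nat) (c : 'I_n -> int) (beta : 'I_n -> {scalar h}),
    (forall k, integrable_root (beta k)) /\
    forall t : h, alpha t = \sum_(k < n) beta k t *~ c k.

Definition integral_weight (lambda : {scalar h}) : Prop :=
  forall alpha : {scalar h}, integrable_root alpha ->
    exists m : int, lambda (coroot alpha) = m%:~R.

(* The inverse image of alpha under flat : h -> h^*, where                     *)
(* flat(t)(s) = kappa(s, t); it is unique if kappa is non-degenerate on h and  *)
(* exists if alpha lies in the image of flat, in particular for alpha a root   *)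
(* and for alpha = 0.                                                          *)
Definition sharp (kappa : {symmetric g}) (alpha : {scalar h}) : h :=
  xget 0 [set t : h | forall s : h, alpha s = kappa (\val s) (\val t)].

Definition grade_index (kappa : {symmetric g}) (lambda : {scalar h})
    (q : rat) : set {scalar h} :=
  [set alpha | (is_root alpha \/ alpha =1 \0) /\
               lambda (sharp kappa alpha) = ratr q].

Definition grade (kappa : {symmetric g}) (lambda : {scalar h})
    (q : rat) : set g :=
  sum_of (grade_index kappa lambda q) (fun alpha => rootspace alpha).

End SplitLieAlgebras.

Definition split_lie {K : fieldType} {g : lieType K} {S : {pred g}}
    (h : subLmodType S) : Prop :=
  maximal_abelian_subalgebra S /\
  exists B : set g, is_basis B /\
    forall b, B b -> forall t : h, exists c : K, [lie \val t, b] = c *: b.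

Definition integrable_roots_connected {K : fieldType} {g : lieType K}
    {S : {pred g}} (h : subLmodType S) : Prop :=
  forall alpha beta : {scalar h},
    integrable_root alpha -> integrable_root beta ->
    integrable_connected alpha beta.

(* Main.v *)
Require Import Defs.
From HB Require Import structures.
From mathcomp Require Import all_boot all_order all_algebra.
From mathcomp Require Import boolp classical_sets.
From mathcomp Require Import ring zify.

Set Implicit Arguments.
Unset Strict Implicit.
Unset Printing Implicit Defensive.

Import Order.TTheory GRing.Theory Num.Theory.
Local Open Scope ring_scope.
Local Open Scope classical_set_scope.

(** Write a# for the element of h that represents a functional a through kappa,
    and a^ for the coroot of a. Since kappa(s, [x, y]) = a(s) kappa(x, y) for
    x in g_a, the space [g_a, g_(-a)] lies on the line through a#; hence
    a# = (2 / N(a)) a^ with N(a) = kappa(a^, a^), for a an integrable root.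

    Rational grading. For a an integrable root, lambda(a#) is
    2 lambda(a^) / N(a), a rational number. Every root is an integral
    combination of integrable ones, so lambda(a#) is rational for every root a
    ([weight_index_rat]). As a |-> a# is additive and [g_a, g_b] lies in
    g_(a + b), collecting the root spaces according to lambda(a#) gives a
    grading; the sum is direct because root spaces of distinct functionals are
    linearly independent ([rootspace_filter]).

    Cyclic support. Two facts about an integrable root a are needed: b(a^) is an
    integer for each root b (representations of sl_2, [root_coroot_int]), and
    the reflection b - b(a^) a of an integrable root b is again integrable, with
    N unchanged ([reflection_integrable], [coroot_reflection]). The reflection
    is realized by the automorphism exp(ad e) exp(- ad f) exp(ad e) of g, where
    (e, a^, f) is an sl_2-triple; the exponential of a locally nilpotent
    derivation is treated first.

    Applying the bound 4 to a and to the reflection of a in b gives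
    (2 - a(b^) b(a^))^2 <= 4, that is 0 <= a(b^) b(a^) <= 4
    ([coroot_pair_bound]). As b(a^) N(b) = a(b^) N(a), the quotient N(a) / N(b)
    of two non-orthogonal integrable roots is thus a multiple of 1/12. Along a
    chain of non-orthogonal integrable roots the first one may be replaced by a
    reflected root with the same N that is not orthogonal to the last one
    ([connected_link]), so N(a) / N(b) is a multiple of 1/12 for any a and b.
    With a fixed, lambda(b#) = 2 lambda(b^) / N(b) is then an integral multiple
    of 1 / (6 N(a)) for each integrable root b, hence for each root b. *)

(** * Rational numbers in a field of characteristic zero *)

Section CharZeroRationals.
Context (K : fieldType) (charK : [pchar K] =i pred0).

Lemma natr_eq0_char0 (n : nat) : (n%:R == 0 :> K) = (n == 0%N).
Proof. exact: (pcharf0P _).1. Qed.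

Lemma intr_eq0_char0 (m : int) : (m%:~R == 0 :> K) = (m == 0).
Proof.
by case: m => n; rewrite ?NegzE ?mulrNz ?oppr_eq0 -?pmulrn natr_eq0_char0.
Qed.

(** The fraction n / d need not be reduced, which makes [ratr] easy to compute on
    sums and products. *)
Lemma ratr_frac (n d : int) : d != 0 ->
  ratr (n%:~R / d%:~R) = n%:~R / d%:~R :> K.
Proof.
move=> d0; set r : rat := _ / _.
have cross : numq r * d = n * denq r.
  have : (numq r)%:~R / (denq r)%:~R = n%:~R / d%:~R :> rat by rewrite divq_num_den.
  move/eqP; rewrite eqr_div ?intr_eq0 ?denq_neq0 // -!rmorphM /= => /eqP.
  exact: intr_inj.
rewrite /ratr; apply/eqP; rewrite eqr_div ?intr_eq0_char0 ?denq_neq0 //.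
by rewrite -!rmorphM /= cross.
Qed.

Lemma ratrD_char0 (p q : rat) : ratr (p + q) = ratr p + ratr q :> K.
Proof.
rewrite -[p]divq_num_den -[q]divq_num_den addf_div ?intr_eq0 ?denq_neq0 //.
rewrite -!rmorphM -rmorphD /= !ratr_frac ?mulf_neq0 ?denq_neq0 //.
by rewrite rmorphD !rmorphM /= -addf_div ?intr_eq0_char0 ?denq_neq0.
Qed.

Lemma ratrM_char0 (p q : rat) : ratr (p * q) = ratr p * ratr q :> K.
Proof.
rewrite -[p]divq_num_den -[q]divq_num_den mulf_div.
rewrite -!rmorphM /= !ratr_frac ?mulf_neq0 ?denq_neq0 //.
by rewrite !rmorphM /= -mulf_div.
Qed.

Lemma ratr_eq0_char0 (p : rat) : (ratr p == 0 :> K) = (p == 0).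
Proof.
by rewrite /ratr mulf_eq0 invr_eq0 !intr_eq0_char0 (negPf (denq_neq0 _)) orbF numq_eq0.
Qed.

Lemma ratr_inj_char0 : injective (ratr : rat -> K).
Proof.
move=> p q pq; apply/eqP; rewrite -subr_eq0 -ratr_eq0_char0 ratrD_char0 pq.
by rewrite -ratrD_char0 subrr ratr_eq0_char0.
Qed.

Lemma ratrV_char0 (p : rat) : ratr p^-1 = (ratr p)^-1 :> K.
Proof.
have [->|p0] := eqVneq p 0; first by rewrite !invr0 (ratr_int K 0) invr0.
apply: (mulfI (x := ratr p)); first by rewrite ratr_eq0_char0.
by rewrite -ratrM_char0 !mulfV ?ratr_eq0_char0 // (ratr_int K 1).
Qed.

End CharZeroRationals.

(** * Exponential of a locally nilpotent endomorphism *)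

Section LocallyNilpotentExponential.
Context (K : fieldType) (charK : [pchar K] =i pred0) (V : lmodType K).

Definition locally_nilpotent (D : V -> V) :=
  forall y, exists n, iter n D y = 0.

Definition divpow (D : V -> V) (n : nat) (y : V) : V := n`!%:R^-1 *: iter n D y.

(** The exponential of D: the series stops at some power of D that kills y, and
    [lexpE] shows that the choice of this power does not matter. *)
Definition lexp (D : V -> V) (y : V) : V :=
  \sum_(0 <= k < xget 0 [set n | iter n D y = 0]) divpow D k y.

Section Linear.
Context (D : {linear V -> V}).

Lemma iter_linearP n c y z :
  iter n D (c *: y + z) = c *: iter n D y + iter n D z.
Proof. by elim: n => //= n ->; rewrite linearP. Qed.

Lemma iter_linear0 n : iter n D 0 = 0.
Proof. by elim: n => //= n ->; rewrite linear0. Qed.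

Lemma iter_linear_sum n m (F : nat -> V) :
  iter n D (\sum_(0 <= k < m) F k) = \sum_(0 <= k < m) iter n D (F k).
Proof.
elim: m => [|m IH]; first by rewrite !big_geq // iter_linear0.
by rewrite !big_nat_recr //= -IH -[X in X + _]scale1r iter_linearP scale1r.
Qed.

Lemma iter_linear_ge m n y : (m <= n)%N -> iter m D y = 0 -> iter n D y = 0.
Proof. by move=> mn y0; rewrite -(subnK mn) iterD y0 iter_linear0. Qed.

Lemma divpowS n y : D (divpow D n y) = n.+1%:R *: divpow D n.+1 y.
Proof.
rewrite /divpow linearZ /= scalerA factS natrM invfM mulrA mulfV ?mul1r //.
by rewrite natr_eq0_char0.
Qed.

Lemma divpow_linearP n c y z :
  divpow D n (c *: y + z) = c *: divpow D n y + divpow D n z.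
Proof. by rewrite /divpow iter_linearP scalerDr !scalerA mulrC. Qed.

Hypothesis nilD : locally_nilpotent D.

Lemma lexpE n y : iter n D y = 0 -> lexp D y = \sum_(0 <= k < n) divpow D k y.
Proof.
move=> yn; rewrite /lexp; set m := xget _ _.
have ym : iter m D y = 0 by apply: (@xgetPex _ 0 [set n | _] (nilD y)).
have tail a b : (a <= b)%N -> iter a D y = 0 ->
    \sum_(0 <= k < b) divpow D k y = \sum_(0 <= k < a) divpow D k y.
  move=> ab ya; rewrite (big_cat_nat (leq0n _) ab) //= [X in _ + X]big_nat [X in _ + X]big1 ?addr0 //.
  by move=> k /andP[ak _]; rewrite /divpow (iter_linear_ge ak ya) scaler0.
by case/orP: (leq_total m n) => mn; [rewrite (tail m n)|rewrite (tail n m)].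
Qed.

Lemma locally_nilpotent2 y z : exists n, iter n D y = 0 /\ iter n D z = 0.
Proof.
have [[m ym] [n zn]] := (nilD y, nilD z); exists (m + n)%N.
by split; [apply: iter_linear_ge ym; rewrite leq_addr
          |apply: iter_linear_ge zn; rewrite leq_addl].
Qed.

Lemma lexpP c y z : lexp D (c *: y + z) = c *: lexp D y + lexp D z.
Proof.
have [n [yn zn]] := locally_nilpotent2 y z.
rewrite !(@lexpE n) //; last by rewrite iter_linearP yn zn scaler0 addr0.
rewrite scaler_sumr -big_split /=; apply: eq_bigr => k _.
exact: divpow_linearP.
Qed.

(** If D^(n+1) kills y, then D^n kills y - exp(D) y, so that y is reached by
    induction on n. *)
Lemma lexp_surj y : exists z, lexp D z = y.
Proof.
have [n] := nilD y; elim: n y => [|n IH] y yn.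
  by exists 0; rewrite (@lexpE 0) ?big_geq.
have [|z zE] := IH (y - lexp D y).
  rewrite (lexpE yn) big_nat_recl // /divpow fact0 invr1 scale1r /= opprD addNKr.
  rewrite -scaleN1r -[_ *: _]addr0 iter_linearP iter_linear0 addr0 iter_linear_sum.
  rewrite big1 ?scaler0 // => k _; rewrite -[_ *: _]addr0 iter_linearP.
  rewrite iter_linear0 addr0 -iterS -iterD addnC.
  by rewrite (@iter_linear_ge n.+1) ?scaler0 //; lia.
by exists (z + y); rewrite -[z]scale1r lexpP scale1r zE subrK.
Qed.

End Linear.
End LocallyNilpotentExponential.

(** * Calculus in a Lie algebra *)

HB.instance Definition _ (K : fieldType) (g : lieType K) (x : g) :=
  GRing.isLinear.Build K g g *:%R (lie_bracket x)
    (fun c y z => lie_bracketPr c y z x).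

Section LieCalculus.
Context (K : fieldType) (g : lieType K).
Implicit Types x y z : g.

Lemma lieDl x y z : [lie x + y, z] = [lie x, z] + [lie y, z].
Proof. by rewrite -[x]scale1r lie_bracketPl !scale1r. Qed.

Lemma lie0l z : [lie 0, z] = 0 :> g.
Proof. by apply: (addrI [lie 0, z]); rewrite -lieDl !addr0. Qed.

Lemma lieZl c x z : [lie c *: x, z] = c *: [lie x, z].
Proof. by rewrite -[c *: x]addr0 lie_bracketPl lie0l addr0. Qed.

Lemma lieZr c x z : [lie x, c *: z] = c *: [lie x, z].
Proof. exact: linearZ. Qed.

Lemma lieC x y : [lie x, y] = - [lie y, x].
Proof.
have := lie_bracketxx (x + y).
rewrite lieDl !linearD /= !lie_bracketxx addr0 add0r => /eqP.
by rewrite addr_eq0 => /eqP.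
Qed.

Lemma lieNl x z : [lie - x, z] = - [lie x, z].
Proof. by rewrite -scaleN1r lieZl scaleN1r. Qed.

Lemma lie_suml (I : Type) (r : seq I) (P : pred I) (F : I -> g) z :
  [lie \sum_(i <- r | P i) F i, z] = \sum_(i <- r | P i) [lie F i, z].
Proof.
by rewrite lieC linear_sum -sumrN; apply: eq_bigr => i _; rewrite -lieC.
Qed.

(** The Jacobi identity in the form used below: ad x is a derivation. *)
Lemma jacobiD x y z : [lie x, [lie y, z]] = [lie [lie x, y], z] + [lie y, [lie x, z]].
Proof.
have /eqP := lie_jacobi x y z.
rewrite [[lie z, x]]lieC [[lie z, _]]lieC linearN /= -addrA addr_eq0.
by rewrite -opprD opprK addrC => /eqP.
Qed.

End LieCalculus.

(** * Exponential of a locally nilpotent derivation *)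

(** Summing over the triangle k + j < N by antidiagonals or by rows: the
    rearrangement behind the product of two exponential series. *)
Lemma sum_triangle (V : nmodType) (F : nat -> nat -> V) (N : nat) :
  \sum_(0 <= n < N) \sum_(0 <= k < n.+1) F k (n - k)%N =
  \sum_(0 <= k < N) \sum_(0 <= j < N - k) F k j.
Proof.
elim: N => [|N IH]; first by rewrite !big_geq.
rewrite big_nat_recr //= IH.
rewrite [RHS](_ : _ = \sum_(0 <= k < N.+1)
    (\sum_(0 <= j < N - k) F k j + F k (N - k)%N)).
  rewrite big_split /= [in RHS]big_nat_recr //= subnn.
  by rewrite [X in _ + X + _](big_geq (leqnn 0)) addr0.
rewrite [LHS]big_nat [RHS]big_nat; apply: eq_bigr => k /andP[_ kN].
by rewrite subSn // big_nat_recr.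
Qed.

Section DerivationExponential.
Context (K : fieldType) (charK : [pchar K] =i pred0) (g : lieType K).
Context (D : {linear g -> g}) (nilD : locally_nilpotent D).
Hypothesis derD : forall y z, D [lie y, z] = [lie D y, z] + [lie y, D z].

(** Leibniz formula for divided powers: the two sides satisfy the same recursion
    D c_n = (n + 1) c_(n+1), and n + 1 is invertible. *)
Lemma divpow_lie n y z : divpow D n [lie y, z] =
  \sum_(0 <= k < n.+1) [lie divpow D k y, divpow D (n - k) z].
Proof.
elim: n => [|n IH]; first by rewrite big_nat1 /divpow fact0 invr1 !scale1r.
have n0 : n.+1%:R != 0 :> K by rewrite natr_eq0_char0.
apply: (scalerI n0); rewrite -divpowS // IH linear_sum.
have -> : \sum_(0 <= k < n.+1) D [lie divpow D k y, divpow D (n - k) z] =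
   \sum_(0 <= k < n.+1) (k.+1%:R *: [lie divpow D k.+1 y, divpow D (n - k) z]
     + (n - k).+1%:R *: [lie divpow D k y, divpow D (n - k).+1 z]).
  by apply: eq_bigr => k _; rewrite derD !divpowS // (lieZl k.+1%:R) (lieZr (n - k).+1%:R).
rewrite big_split /=.
(* Both sums are extended to 0 <= k <= n + 1 by a term with coefficient zero. *)
have -> : \sum_(0 <= k < n.+1) k.+1%:R *: [lie divpow D k.+1 y, divpow D (n - k) z]
   = \sum_(0 <= k < n.+2) k%:R *: [lie divpow D k y, divpow D (n.+1 - k) z].
  rewrite [RHS]big_nat_recl // mulr0n scale0r add0r.
  by apply: eq_bigr => k _; rewrite subSS.
have -> : \sum_(0 <= k < n.+1)
      (n - k).+1%:R *: [lie divpow D k y, divpow D (n - k).+1 z]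
   = \sum_(0 <= k < n.+2)
      (n.+1 - k)%:R *: [lie divpow D k y, divpow D (n.+1 - k) z].
  rewrite [RHS]big_nat_recr //= subnn mulr0n scale0r addr0 big_nat [RHS]big_nat.
  by apply: eq_bigr => k /andP[_ kn]; rewrite subSn.
rewrite -big_split scaler_sumr /= big_nat [RHS]big_nat.
apply: eq_bigr => k /andP[_ kn]; rewrite -scalerDl -natrD subnKC //.
Qed.

(** The exponential of a derivation is an automorphism: expand exp(D) [y, z] by
    [divpow_lie] and sum over the antidiagonals. *)
Lemma lexp_lie y z : lexp D [lie y, z] = [lie lexp D y, lexp D z].
Proof.
have [p [yp zp]] := locally_nilpotent2 nilD y z.
have dp0 w k : iter p D w = 0 -> (p <= k)%N -> divpow D k w = 0.
  by move=> wp pk; rewrite /divpow (iter_linear_ge pk wp) scaler0.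
have big0 k n : (p + p <= n)%N -> [lie divpow D k y, divpow D (n - k) z] = 0.
  move=> pn; have [pk|kp] := leqP p k; first by rewrite (dp0 y) // lie0l.
  by rewrite (dp0 z) ?linear0 //; lia.
have yz0 : iter (p + p) D [lie y, z] = 0.
  have /eqP : divpow D (p + p) [lie y, z] = 0.
    by rewrite divpow_lie big1 // => k _; exact: big0.
  rewrite /divpow scaler_eq0 invr_eq0 natr_eq0_char0 // -leqn0 leqNgt fact_gt0.
  by move/eqP.
have le2 w : iter p D w = 0 -> iter (p + p) D w = 0.
  by apply: iter_linear_ge; rewrite leq_addr.
(* The triangle k + j < 2p contains the square k, j < p, outside of which all
   terms vanish. *)
rewrite (lexpE nilD yz0) (eq_bigr _ (fun k _ => divpow_lie k y z)).
rewrite (sum_triangle (fun k j => [lie divpow D k y, divpow D j z])).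
rewrite (lexpE nilD (le2 y yp)) (lexpE nilD zp) lie_suml.
apply: eq_bigr => k _; have [pk|kp] := leqP p k.
  by rewrite (dp0 y k) // lie0l big1 // => j _; rewrite lie0l.
rewrite [RHS]linear_sum.
rewrite (big_cat_nat (n := p) (leq0n _)) /=; last lia.
rewrite [X in _ + X]big_nat [X in _ + X]big1 ?addr0 // => j /andP[pj _].
by rewrite (dp0 z) ?linear0.
Qed.

End DerivationExponential.

(** * Sums of families of subspaces *)

Section SumOf.
Context (K : fieldType) (V : lmodType K) (I : Type) (D : set I) (F : I -> set V).

Lemma sum_of_term i x : D i -> F i x -> sum_of D F x.
Proof. by move=> Di Fx; exists 1%N, (fun=> i), (fun=> x); rewrite big_ord1. Qed.

Lemma sum_of0 : sum_of D F 0.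
Proof.
exists 0%N, (fun k : 'I_0 => False_rect I (notF (ltn_ord k))), (fun=> 0).
by split=> [[]//|]; rewrite big_ord0.
Qed.

Lemma sum_ofD x y : sum_of D F x -> sum_of D F y -> sum_of D F (x + y).
Proof.
move=> [n [i [u [iu ->]]]] [m [j [v [jv ->]]]].
exists (n + m)%N, (fun k => match split k with inl a => i a | inr b => j b end).
exists (fun k => match split k with inl a => u a | inr b => v b end); split.
  by move=> k; case: (split k).
rewrite big_split_ord /=; congr (_ + _); apply: eq_bigr => k _.
  by rewrite (unsplitK (inl k)).
by rewrite (unsplitK (inr k)).
Qed.

Lemma sum_of_sum n (x : 'I_n -> V) :
  (forall k, sum_of D F (x k)) -> sum_of D F (\sum_k x k).
Proof.
by move=> xP; elim/big_ind: _ => //; [exact: sum_of0|exact: sum_ofD].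
Qed.

Lemma sum_of_submod : (forall i c x, F i x -> F i (c *: x)) ->
  submod_closed [in sum_of D F].
Proof.
move=> FZ; split; first by rewrite inE; exact: sum_of0.
move=> c x y; rewrite !inE => -[n [i [u [iu ->]]]] yP.
apply: sum_ofD => //; rewrite scaler_sumr; apply: sum_of_sum => k.
by have [Di Fu] := iu k; exact: (sum_of_term Di (FZ _ c _ Fu)).
Qed.

End SumOf.

(** * Root spaces *)

Section SplitQuadratic.
Context (K : fieldType) (charK : [pchar K] =i pred0).
Context (g : lieType K) (S : {pred g}) (h : subLmodType S).
Implicit Types (s t u : h) (alpha beta gamma : {scalar h}) (x y z : g).

Lemma scalar_ext alpha beta : alpha =1 beta -> alpha = beta.
Proof.
case: alpha => a [[a1] [a2]]; case: beta => b [[b1] [b2]] /= /funext ab.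
move: a1 b1 a2 b2; rewrite ab => a1 b1 a2 b2.
by rewrite (Prop_irrelevance a1 b1) (Prop_irrelevance a2 b2).
Qed.

Lemma exists_scalar (f : h -> K) :
  (forall c s t, f (c *: s + t) = c * f s + f t) ->
  exists alpha : {scalar h}, alpha =1 f.
Proof.
move=> fP; pose m := GRing.isLinear.Build K h K *%R f fP.
by pose F : {scalar h} := HB.pack f m; exists F.
Qed.

Lemma val_linearP c s t : \val (c *: s + t) = c *: \val s + \val t :> g.
Proof. exact: linearP. Qed.

Lemma val_linearZ c s : \val (c *: s) = c *: \val s :> g.
Proof. by rewrite linearZ. Qed.

Lemma val_linearB s t : \val (s - t) = \val s - \val t :> g.
Proof. by rewrite linearB. Qed.

Lemma scalarB alpha s t : alpha (s - t) = alpha s - alpha t.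
Proof. exact: linearB. Qed.

Lemma scalarD alpha s t : alpha (s + t) = alpha s + alpha t.
Proof. exact: linearD. Qed.

Lemma scalarZ alpha c s : alpha (c *: s) = c * alpha s.
Proof. by rewrite linearZ. Qed.

Lemma rootspace0 (a : h -> K) : rootspace a (0 : g).
Proof. by move=> t; rewrite linear0 scaler0. Qed.

Lemma rootspaceP (a : h -> K) c x y :
  rootspace a x -> rootspace a y -> rootspace a (c *: x + y).
Proof.
move=> xa ya t; rewrite lie_bracketPr xa ya scalerDr !scalerA.
by rewrite mulrC.
Qed.

Lemma rootspaceZ (a : h -> K) c x : rootspace a x -> rootspace a (c *: x).
Proof. by move=> xa; rewrite -[_ *: _]addr0; apply/rootspaceP/rootspace0. Qed.

Lemma rootspace_eq (a b : h -> K) x : a =1 b -> rootspace a x -> rootspace b x.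
Proof. by move=> ab xa t; rewrite -ab. Qed.

Lemma rootspace_lie (a b : h -> K) x y : rootspace a x -> rootspace b y ->
  rootspace (fun s => a s + b s) [lie x, y].
Proof.
by move=> xa yb t; rewrite jacobiD xa yb lieZl lieZr scalerDl.
Qed.

Definition weight : set {scalar h} := [set alpha | is_root alpha \/ alpha =1 \0].

Lemma rootspace_weight alpha x : rootspace alpha x -> x != 0 -> weight alpha.
Proof.
move=> xa x0; have [a0|a0] := pselect (alpha =1 \0); first by right.
by left; split=> //; exists x.
Qed.

(** Apply ad t - i_0(t), for some t with i_0(t) <> beta(t): it kills the first
    summand, scales the others, and multiplies y by a nonzero scalar. *)
Lemma rootspace_separated beta n (i : 'I_n -> {scalar h}) (x : 'I_n -> g) y :
  rootspace beta y -> (forall k, rootspace (i k) (x k)) ->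
  (forall k, i k <> beta) -> y + \sum_k x k = 0 -> y = 0.
Proof.
elim: n i x y => [|n IH] i x y yb xi ib; first by rewrite big_ord0 addr0.
rewrite big_ord_recl => sum0.
have [t bt] : exists t, i ord0 t != beta t.
  apply: contrapT => /forallNP H; apply: (ib ord0); apply: scalar_ext => t.
  by apply/eqP; move/negP: (H t); rewrite negbK.
pose w gamma := gamma t - i ord0 t.
have wE gamma v : rootspace gamma v ->
    [lie \val t, v] - i ord0 t *: v = w gamma *: v.
  by move=> vg; rewrite vg -scalerBl.
have : w beta *: y = 0.
  apply: (IH (fun k => i (lift ord0 k)) (fun k => w (i (lift ord0 k)) *: x (lift ord0 k))).
  - exact: rootspaceZ.
  - by move=> k; exact: rootspaceZ.
  - by move=> k; exact: ib.
  have : [lie \val t, y + (x ord0 + \sum_(k < n) x (lift ord0 k))]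
      - i ord0 t *: (y + (x ord0 + \sum_(k < n) x (lift ord0 k))) = 0.
    by rewrite sum0 linear0 scaler0 subr0.
  rewrite !linearD /= linear_sum scaler_sumr.
  rewrite addrACA (wE beta) // addrACA (wE (i ord0)) //.
  rewrite (subrr _ : w (i ord0) = 0) scale0r add0r -sumrB => sumw.
  rewrite -[RHS]sumw; congr (_ + _).
  by apply: eq_bigr => k _; rewrite -wE.
move/eqP; rewrite scaler_eq0 /w subr_eq0 eq_sym (negPf bt) /=.
by move/eqP.
Qed.

(** Linear independence of the root spaces, in a form that allows repetitions
    among the functionals and any way of grouping them: the partial sum over the
    functionals in P vanishes. With P a singleton this is the independence of the
    root spaces, with P a level set of lambda(a#) that of the graded pieces. *)
Lemma rootspace_filter (T : finType) (a : T -> {scalar h}) (x : T -> g)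
    (P : set {scalar h}) :
  (forall k, rootspace (a k) (x k)) -> \sum_k x k = 0 ->
  \sum_(k | `[< P (a k) >]) x k = 0.
Proof.
move=> xa sum0.
have single beta : \sum_(k | `[< a k = beta >]) x k = 0.
  have := sum0; rewrite (bigID (fun k => `[< a k = beta >])) /=.
  set y := \sum_(k | `[< _ >]) _ => sum0'.
  pose F := [pred k | ~~ `[< a k = beta >]].
  apply: (@rootspace_separated beta #|F| (fun k => a (enum_val k))
    (fun k => x (enum_val k))) => //.
  - rewrite /y; elim/big_ind: _ => [|u v ub vb|k /asboolP <-] //.
      exact: rootspace0.
    by rewrite -[u]scale1r; exact: rootspaceP.
  - by move=> k; have := enum_valP k; rewrite inE => /asboolPn.
  by rewrite -(big_enum_val (A := F) x).
(* rep k is a representative of the set of indices with the same functional as k;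
   it splits the sum into sums over a single functional. *)
pose rep k := odflt k [pick j | `[< a j = a k >]].
have repE k j : `[< a j = a k >] -> rep j = rep k.
  move=> /asboolP jk; rewrite /rep (@eq_pick _ _ (fun i => `[< a i = a k >])).
    by case: pickP => // /(_ k); rewrite asboolT.
  by move=> i; rewrite jk.
have repK k : a (rep k) = a k.
  by rewrite /rep; case: pickP => [j /asboolP|].
rewrite (partition_big rep predT) //= big1 // => j _.
have [Pj|nPj] := pselect (P (a j)); last first.
  rewrite big_pred0 // => k; apply: contra_notF nPj => /andP[/asboolP Pk /eqP <-].
  by rewrite repK.
have [[k rk]|nk] := pselect (exists k, rep k = j); last first.
  by rewrite big_pred0 // => k; apply: contra_notF nk => /andP[_ /eqP <-]; exists k.
apply: etrans (single (a j)); apply: eq_bigl => i; apply/andP/asboolP => [[_ /eqP <-]|ij].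
  by rewrite repK.
split; first by rewrite ij asboolT.
by rewrite -rk (@repE k) // asboolT // -(repK k) rk.
Qed.

(** * The invariant form on the splitting subalgebra *)

Context (kappa : {symmetric g}) (split_gh : split_lie h).
Context (kappaP : invariant_nondegenerate kappa).

Local Notation k_ s t := (kappa (\val (s : h)) (\val (t : h))).

Lemma formC x y : kappa x y = kappa y x.
Proof. by rewrite hermC /= expr0 mul1r. Qed.

Lemma formPr c x y z : kappa x (c *: y + z) = c * kappa x y + kappa x z.
Proof. by rewrite linearDr linearZr. Qed.

Lemma form0r x : kappa x 0 = 0.
Proof. by rewrite linear0r. Qed.

Lemma formZr c x y : kappa x (c *: y) = c * kappa x y.
Proof. by rewrite -[c *: y]addr0 formPr form0r addr0. Qed.

Lemma formZl c x y : kappa (c *: x) y = c * kappa x y.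
Proof. by rewrite formC formZr formC. Qed.

Lemma form_sumr x (I : Type) (r : seq I) (P : pred I) (F : I -> g) :
  kappa x (\sum_(i <- r | P i) F i) = \sum_(i <- r | P i) kappa x (F i).
Proof. by rewrite linear_sumr. Qed.

Lemma form_inv x y z : kappa [lie x, y] z = kappa x [lie y, z].
Proof. by case: kappaP. Qed.

Lemma val_lie s t : [lie \val s, \val t] = 0 :> g.
Proof. have [[[_ ab] _] _] := split_gh; exact: (ab _ _ (valP s) (valP t)). Qed.

(** By maximality: x and the splitting subalgebra span an abelian subalgebra. *)
Lemma centralizer_split x : (forall t, [lie \val t, x] = 0) -> exists t, x = \val t.
Proof.
move=> xc; have [[Sab Smax] _] := split_gh.
have xc' t : [lie x, \val t] = 0 by rewrite lieC xc oppr0.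
pose b : {pred g} := [pred y | `[< exists c t, y = c *: x + \val t >]].
have bab : abelian_subalgebra b.
  split; first split.
  - by apply/asboolP; exists 0, 0; rewrite scale0r linear0 addr0.
  - move=> c _ _ /asboolP[c1 [t1 ->]] /asboolP[c2 [t2 ->]].
    apply/asboolP; exists (c * c1 + c2), (c *: t1 + t2).
    by rewrite val_linearP scalerDr scalerA scalerDl addrACA.
  - move=> _ _ /asboolP[c1 [t1 ->]] /asboolP[c2 [t2 ->]].
    by rewrite !(lieDl, linearD) /= !(lieZl, lieZr) xc xc' val_lie lie_bracketxx
      !scaler0 !addr0.
have xS : x \in S.
  apply: (Smax b bab).
    move=> y yS; apply/asboolP; exists 0, (Sub y yS).
    by rewrite scale0r add0r SubK.
  by apply/asboolP; exists 1, 0; rewrite scale1r linear0 addr0.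
by exists (Sub x xS); rewrite SubK.
Qed.

(** The eigenvalues depend linearly on t because x is nonzero; for x = 0 any
    functional will do, and zero is chosen. *)
Lemma eigenvector_weight x : (forall t, exists c, [lie \val t, x] = c *: x) ->
  exists alpha, weight alpha /\ rootspace alpha x.
Proof.
move=> xeig; have [->|x0] := eqVneq x 0.
  have [|alpha a0] := @exists_scalar \0; first by move=> *; rewrite mulr0 addr0.
  by exists alpha; split; [right|exact: rootspace0].
have [f fE] := choice xeig.
have [|alpha aE] := @exists_scalar f.
  move=> c s t.
  have /eqP : (f (c *: s + t) - (c * f s + f t)) *: x = 0.
    rewrite scalerBl -fE val_linearP lie_bracketPl !fE.
    by rewrite scalerDl scalerA subrr.
  by rewrite scaler_eq0 (negPf x0) orbF subr_eq0 => /eqP.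
have xa : rootspace alpha x by move=> t; rewrite aE fE.
by exists alpha; split=> //; exact: rootspace_weight xa x0.
Qed.

Lemma weight_decomposition x :
  sum_of weight (fun alpha => rootspace alpha) x.
Proof.
have [_ [B [[_ Bspan] Beig]]] := split_gh.
have [n [b [c [Bb ->]]]] := Bspan x.
have [i iP] := choice (fun k => eigenvector_weight (Beig (b k) (Bb k))).
exists n, i, (fun k => c k *: b k); split=> // k.
by have [? ?] := iP k; split=> //; exact: rootspaceZ.
Qed.

(** An element t of h is orthogonal to every vector x of root i: for i(s) <> 0,
    i(s) kappa(t, x) = kappa(t, [s, x]) = kappa([t, s], x) = 0. So an element of h
    orthogonal to h is orthogonal to g. *)
Lemma form_nondegenerate_split t : (forall s, k_ s t = 0) -> t = 0.
Proof.
move=> t0; apply: (@val_inj _ _ h); rewrite linear0; apply: kappaP.2 => y.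
have [n [i [x [xi ->]]]] := weight_decomposition y.
rewrite form_sumr big1 // => k _.
have [_ xk] := xi k; have [i0|] := pselect (i k =1 \0).
  have [s ->] : exists s, x k = \val s.
    by apply: centralizer_split => s; rewrite xk i0 scale0r.
  by rewrite formC; exact: t0.
move/existsNP => [s /eqP is0]; apply: (mulfI is0).
by rewrite mulr0 -formZr -xk -form_inv val_lie formC form0r.
Qed.

Lemma kform_inj s t : (forall u, k_ u s = k_ u t) -> s = t.
Proof.
move=> st; apply/eqP; rewrite -subr_eq0; apply/eqP/form_nondegenerate_split => u.
have val_sub : \val (s - t) = (-1) *: \val t + \val s :> g.
  by rewrite linearB scaleN1r addrC.
by rewrite val_sub formPr mulN1r addrC st subrr.
Qed.

(** * Coroots and sl_2-triples *)

Lemma two_neq0_char0 : 2 != 0 :> K.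
Proof. by rewrite (natr_eq0_char0 charK 2). Qed.

Lemma form_bracket_root (a : h -> K) x y s :
  rootspace a x -> kappa (\val s) [lie x, y] = a s * kappa x y.
Proof. by move=> xa; rewrite -form_inv xa formZl. Qed.

(** The defining pair of an integrable root, rescaled to an sl_2-triple. The
    coroot is t scaled by 2 / alpha(t), the line of t being all of
    [g_alpha, g_(-alpha)] by [form_bracket_root]. *)
Lemma integrable_sl2 alpha : integrable_root alpha ->
  exists e f : g,
    [/\ rootspace alpha e, rootspace (fun s => - alpha s) f,
        [lie e, f] = \val (coroot alpha), alpha (coroot alpha) = 2 &
        ad_locally_nilpotent e /\ ad_locally_nilpotent f].
Proof.
move=> [_ [x [y [t [[xa ya tE at0] [xnil ynil]]]]]].
have kt s : k_ s t = alpha s * kappa x y by rewrite tE (form_bracket_root _ _ xa).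
have kxy0 : kappa x y != 0.
  apply: contra_neq at0 => xy0; rewrite (@form_nondegenerate_split t) ?linear0 //.
  by move=> s; rewrite kt xy0 mulr0.
have corootE : coroot alpha = (2 / alpha t) *: t.
  rewrite /coroot; apply: xget_unique => [|u [[n [a [b [ab uE]]]] au2]].
    split; last by rewrite scalarZ divfK.
    exists 1%N, (fun=> (2 / alpha t) *: x), (fun=> y); split.
      by move=> _; split=> //; exact: rootspaceZ.
    by rewrite big_ord1 lieZl -tE linearZ.
  have ku s : k_ s u = alpha s * \sum_k kappa (a k) (b k).
    rewrite uE form_sumr mulr_sumr; apply: eq_bigr => k _.
    by rewrite (form_bracket_root _ _ (ab k).1).
  set c := \sum_k _ in ku.
  have utE : u = (c / kappa x y) *: t.
    by apply: kform_inj => s; rewrite ku val_linearZ formZr kt mulrCA divfK.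
  rewrite utE; congr (_ *: _); apply: (canRL (mulfK at0)).
  by rewrite -scalarZ -utE.
exists ((2 / alpha t) *: x), y; split=> //.
- exact: rootspaceZ.
- by rewrite lieZl -tE corootE linearZ.
- by rewrite corootE scalarZ divfK.
split=> // z; have [n zn] := xnil z; exists n.
suff -> : iter n (fun z => [lie (2 / alpha t) *: x, z]) z =
    (2 / alpha t) ^+ n *: iter n (fun z => [lie x, z]) z by rewrite zn scaler0.
elim: {zn} n => [|n IH] /=; first by rewrite scale1r.
by rewrite IH lieZl lieZr scalerA exprS.
Qed.

Lemma coroot_root alpha : integrable_root alpha -> alpha (coroot alpha) = 2.
Proof. by move=> /integrable_sl2[e [f []]]. Qed.

Definition coroot_norm alpha : K := k_ (coroot alpha) (coroot alpha).

(** Up to scaling, the coroot represents the root. *)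
Lemma form_coroot alpha s : integrable_root alpha ->
  2 * k_ s (coroot alpha) = alpha s * coroot_norm alpha.
Proof.
move=> /integrable_sl2[e [f [ea fa efE a2 _]]].
have ks u : k_ u (coroot alpha) = alpha u * kappa e f.
  by rewrite -efE (form_bracket_root _ _ ea).
by rewrite /coroot_norm !ks a2 mulrCA.
Qed.

Lemma coroot_norm_neq0 alpha : integrable_root alpha -> coroot_norm alpha != 0.
Proof.
move=> ia; apply/eqP => n0; move/eqP: (coroot_root ia).
rewrite (@form_nondegenerate_split (coroot alpha)).
  by rewrite linear0 eq_sym (negPf two_neq0_char0).
move=> s; apply: (mulfI two_neq0_char0).
by rewrite form_coroot // n0 !mulr0.
Qed.

(** The second hypothesis says that u represents a multiple of alpha, with the
    factor forced by alpha(u) = 2. *)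
Lemma coroot_unique alpha u : integrable_root alpha -> alpha u = 2 ->
  (forall s, 2 * k_ s u = alpha s * k_ u u) -> u = coroot alpha.
Proof.
move=> ia au ku; set N := coroot_norm alpha.
have uE : N *: u = k_ u u *: coroot alpha.
  apply: kform_inj => s; apply: (mulfI two_neq0_char0).
  by rewrite !val_linearZ !formZr mulrCA ku [RHS]mulrCA form_coroot // -/N; ring.
have := congr1 alpha uE; rewrite !scalarZ au coroot_root //.
move/(mulIf two_neq0_char0) => NE.
by apply: (scalerI (coroot_norm_neq0 ia)); rewrite -/N uE NE.
Qed.

(** Both sides are 2 kappa(alpha^, beta^). *)
Lemma coroot_pair alpha beta : integrable_root alpha -> integrable_root beta ->
  beta (coroot alpha) * coroot_norm beta = alpha (coroot beta) * coroot_norm alpha.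
Proof. by move=> ia ib; rewrite -!form_coroot // formC. Qed.

(** Applying e to v repeatedly, one reaches a vector w killed by e, of weight
    mu = c + 2n. Applying f to w repeatedly, one reaches f^(j+1) w = 0 with
    f^j w <> 0; as e f^(j+1) w = (j + 1) (mu - j) f^j w, it follows that mu = j. *)
Lemma sl2_weight_int (e f k v : g) (c : K) :
  [lie k, e] = 2 *: e -> [lie k, f] = - 2 *: f -> [lie e, f] = k ->
  ad_locally_nilpotent e -> ad_locally_nilpotent f ->
  v != 0 -> [lie k, v] = c *: v -> exists m : int, c = m%:~R.
Proof.
move=> ke kf ef enil fnil v0 kv.
have [n] : exists n w, [/\ w != 0, [lie e, w] = 0 & [lie k, w] = (c + (2 * n)%:R) *: w].
  have ex : exists n, iter n (fun z => [lie e, z]) v == 0.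
    by have [n vn] := enil v; exists n; rewrite vn.
  case: (ex_minnP ex) => [[|n] /eqP vn nmin]; first by rewrite (vn : v = 0) eqxx in v0.
  exists n, (iter n (fun z => [lie e, z]) v); split=> //.
    by apply/negP => /nmin; rewrite ltnn.
  elim: {vn nmin} n => [|n IH] /=; first by rewrite addr0.
  rewrite jacobiD ke IH lieZl lieZr -scalerDl; congr (_ *: _).
  by rewrite mulnS natrD; ring.
move=> [w [w0 ew kw]]; set mu := c + _ in kw.
have fk j : [lie k, iter j (fun z => [lie f, z]) w] =
    (mu - (2 * j)%:R) *: iter j (fun z => [lie f, z]) w.
  elim: j => [|j IH] /=; first by rewrite subr0.
  rewrite jacobiD kf IH lieZl lieZr -scalerDl; congr (_ *: _).
  by rewrite mulnS natrD; ring.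
have efk j : [lie e, iter j.+1 (fun z => [lie f, z]) w] =
    (j.+1%:R * (mu - j%:R)) *: iter j (fun z => [lie f, z]) w.
  elim: j => [|j IH].
    by rewrite /= jacobiD ew linear0 addr0 ef kw subr0 mul1r.
  rewrite [iter j.+2 _ _]/= jacobiD -iterS IH ef fk lieZr -iterS -scalerDl.
  by congr (_ *: _); rewrite mulnS !natrD -[j.+2]addn2 -[j.+1]addn1 !natrD; ring.
have ex : exists j, iter j (fun z => [lie f, z]) w == 0.
  by have [j wj] := fnil w; exists j; rewrite wj.
case: (ex_minnP ex) => [[|j] /eqP wj jmin]; first by rewrite (wj : w = 0) eqxx in w0.
have /eqP := efk j; rewrite wj linear0 eq_sym scaler_eq0 mulf_eq0.
rewrite natr_eq0_char0 //= => /orP[|/jmin]; last by rewrite ltnn.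
rewrite subr_eq0 /mu => /eqP cE; exists (j%:Z - (2 * n)%:Z).
by rewrite rmorphB /= -!pmulrn -cE addrK.
Qed.

Lemma root_coroot_int alpha beta : integrable_root alpha -> is_root beta ->
  exists m : int, beta (coroot alpha) = m%:~R.
Proof.
move=> /integrable_sl2[e [f [ea fa ef a2 [enil fnil]]]] [_ [v [vb v0]]].
apply: (@sl2_weight_int e f (\val (coroot alpha)) v) => //.
- by rewrite ea a2.
- by rewrite fa a2.
Qed.

(** * Reflections in integrable roots *)

Section Reflection.
Context (alpha : {scalar h}) (e f : g).
Hypotheses (ea : rootspace alpha e) (fa : rootspace (fun s => - alpha s) f).
Hypotheses (ef : [lie e, f] = \val (coroot alpha)) (a2 : alpha (coroot alpha) = 2).
Hypotheses (enil : ad_locally_nilpotent e) (fnil : ad_locally_nilpotent f).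

Let nilNf : locally_nilpotent (lie_bracket (- f)).
Proof.
move=> z; have [n zn] := fnil z; exists n.
suff -> : iter n (lie_bracket (- f)) z = (-1) ^+ n *: iter n (fun z => [lie f, z]) z.
  by rewrite zn scaler0.
elim: {zn} n => [|n IH] /=; first by rewrite scale1r.
by rewrite IH lieNl lieZr exprS -scalerA scaleN1r.
Qed.

(** The automorphism exp(ad e) exp(- ad f) exp(ad e) of g lifts the reflection in
    alpha. *)
Definition weyl_aut z : g :=
  lexp (lie_bracket e) (lexp (lie_bracket (- f)) (lexp (lie_bracket e) z)).

Lemma weyl_autP c y z : weyl_aut (c *: y + z) = c *: weyl_aut y + weyl_aut z.
Proof. by rewrite /weyl_aut !lexpP. Qed.

Lemma weyl_aut_lie y z : weyl_aut [lie y, z] = [lie weyl_aut y, weyl_aut z].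
Proof. by rewrite /weyl_aut !lexp_lie // => *; exact: jacobiD. Qed.

Lemma weyl_aut_surj y : exists z, weyl_aut z = y.
Proof.
have [y1 <-] := lexp_surj enil y; have [y2 <-] := lexp_surj nilNf y1.
by have [z <-] := lexp_surj enil y2; exists z.
Qed.

Lemma lexp2 (x y : g) : locally_nilpotent (lie_bracket x) ->
  [lie x, [lie x, y]] = 0 -> lexp (lie_bracket x) y = y + [lie x, y].
Proof.
move=> xnil y2; rewrite (@lexpE _ _ _ xnil 2) //.
by rewrite big_nat_recr // big_nat1 /divpow !invr1 !scale1r.
Qed.

Lemma weyl_aut_val t : weyl_aut (\val t) = \val (t - alpha t *: coroot alpha).
Proof.
have et s : [lie e, \val s] = - alpha s *: e by rewrite lieC ea scaleNr.
have ft s : [lie f, \val s] = alpha s *: f by rewrite lieC fa scaleNr opprK.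
have fe : [lie f, e] = - \val (coroot alpha) by rewrite lieC ef.
have exp_et s : lexp (lie_bracket e) (\val s) = - alpha s *: e + \val s.
  by rewrite lexp2 // et ?lieZr ?lie_bracketxx ?scaler0 // addrC.
have exp_ft s : lexp (lie_bracket (- f)) (\val s) = - alpha s *: f + \val s.
  have nft : [lie - f, \val s] = - alpha s *: f by rewrite lieNl ft scaleNr.
  by rewrite lexp2 // nft ?lieZr ?lieNl ?lie_bracketxx ?oppr0 ?scaler0 // addrC.
have exp_fe : lexp (lie_bracket (- f)) e = e + \val (coroot alpha) - f.
  have d1 : [lie - f, e] = \val (coroot alpha) by rewrite lieNl fe opprK.
  have d2 : [lie - f, \val (coroot alpha)] = - 2 *: f by rewrite lieNl ft a2 scaleNr.
  rewrite (@lexpE _ _ _ nilNf 3).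
    rewrite !big_nat_recr //= big_geq // add0r /divpow /= d1 d2 !invr1 !scale1r.
    by rewrite scalerA mulrN mulVf ?scaleN1r // two_neq0_char0.
  by rewrite /= d1 d2 lieZr lieNl lie_bracketxx oppr0 scaler0.
have exp_ee : lexp (lie_bracket e) e = e.
  by rewrite lexp2 // lie_bracketxx ?linear0 ?addr0.
(* With a = alpha(t) and k the coroot, the images of t are successively t - a e,
   then (t - a f) - a (e + k - f) = (t - a k) - a e, and t - a k. *)
rewrite /weyl_aut exp_et lexpP // exp_fe exp_ft.
have -> : - alpha t *: (e + \val (coroot alpha) - f) + (- alpha t *: f + \val t) =
    - alpha t *: e + \val (t - alpha t *: coroot alpha).
  rewrite val_linearB val_linearZ !scalerDr !scaleNr scalerN opprK.
  rewrite [LHS]addrA addrK -addrA; congr (_ + _).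
  by rewrite addrC.
rewrite lexpP // exp_ee exp_et scalarB scalarZ a2.
rewrite addrA -scalerDl.
suff -> : - alpha t - (alpha t - alpha t * 2) = 0 by rewrite scale0r add0r.
by ring.
Qed.

Definition coreflect t : h := t - alpha t *: coroot alpha.

Lemma coreflectK : involutive coreflect.
Proof.
move=> t; rewrite /coreflect scalarB scalarZ a2 -addrA -opprD -scalerDl.
suff -> : alpha t + (alpha t - alpha t * 2) = 0 by rewrite scale0r subr0.
by ring.
Qed.

(** As the automorphism sends coreflect s to s,
    [s, weyl_aut x] = weyl_aut [coreflect s, x]. *)
Lemma weyl_aut_rootspace (b : h -> K) x : rootspace b x ->
  rootspace (b \o coreflect) (weyl_aut x).
Proof.
move=> xb s /=; rewrite -{1}[s]coreflectK -weyl_aut_val -weyl_aut_lie xb.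
have z0 : weyl_aut 0 = 0.
  by apply: (addIr (weyl_aut 0)); rewrite -{1}[weyl_aut 0]scale1r -weyl_autP scale1r !add0r.
by rewrite -[X in weyl_aut X]addr0 weyl_autP z0 addr0.
Qed.

(** Local nilpotency is transported because the automorphism is surjective. *)
Lemma weyl_aut_nil x : ad_locally_nilpotent x -> ad_locally_nilpotent (weyl_aut x).
Proof.
move=> xnil y; have [z <-] := weyl_aut_surj y; have [n zn] := xnil z; exists n.
suff -> : iter n (fun z => [lie weyl_aut x, z]) (weyl_aut z) =
    weyl_aut (iter n (fun z => [lie x, z]) z).
  rewrite zn; apply: (addIr (weyl_aut 0)).
  by rewrite -{1}[weyl_aut 0]scale1r -weyl_autP scale1r !add0r.
by elim: {zn} n => //= n ->; rewrite weyl_aut_lie.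
Qed.

End Reflection.

(** Transport a pair of root vectors that makes beta integrable by the
    automorphism [weyl_aut]. *)
Lemma reflection_integrable alpha beta :
  integrable_root alpha -> integrable_root beta ->
  exists gamma, integrable_root gamma /\
    forall s, gamma s = beta s - beta (coroot alpha) * alpha s.
Proof.
move=> /integrable_sl2[e [f [ea fa ef a2 [enil fnil]]]].
move=> [_ [x [y [t [[xb yb tE bt] [xnil ynil]]]]]].
pose phi := weyl_aut e f; pose sig := coreflect alpha.
have [|gamma gE] := @exists_scalar (fun s => beta (sig s)).
  move=> c u v; rewrite /sig /coreflect !scalarB !scalarZ !linearP /=; ring.
have xg : rootspace gamma (phi x).
  apply: rootspace_eq (weyl_aut_rootspace ea fa ef a2 enil fnil xb).
  by move=> s; rewrite gE.
have yg : rootspace (fun s => - gamma s) (phi y).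
  apply: rootspace_eq (weyl_aut_rootspace ea fa ef a2 enil fnil yb).
  by move=> s; rewrite gE.
have gt0 : gamma (sig t) != 0 by rewrite gE /sig coreflectK.
have tE' : \val (sig t) = [lie phi x, phi y].
  by rewrite -weyl_aut_lie // -tE (weyl_aut_val ea fa ef a2).
exists gamma; split; last first.
  by move=> s; rewrite gE /sig /coreflect scalarB scalarZ mulrC.
split.
  split; first by move=> g0; rewrite g0 eqxx in gt0.
  exists (phi x); split=> //; apply/eqP => px0; move: tE'.
  rewrite px0 lie0l => t0.
  by move: gt0; rewrite (_ : sig t = 0) ?linear0 ?eqxx //;
    apply: (@val_inj _ _ h); rewrite linear0.
by exists (phi x), (phi y), (sig t); split=> //; split; apply: weyl_aut_nil.
Qed.

(** The element u = beta^ - alpha(beta^) alpha^ represents a multiple of gamma and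
    satisfies gamma(u) = 2; both read off from [form_coroot] and [coroot_pair]. *)
Lemma coroot_reflection alpha beta gamma :
  integrable_root alpha -> integrable_root beta -> integrable_root gamma ->
  (forall s, gamma s = beta s - beta (coroot alpha) * alpha s) ->
  coroot gamma = coroot beta - alpha (coroot beta) *: coroot alpha /\
  coroot_norm gamma = coroot_norm beta.
Proof.
move=> ia ib ig gE; set u := _ - _.
have ku s : 2 * k_ s u = gamma s * coroot_norm beta.
  have -> : \val u = - alpha (coroot beta) *: \val (coroot alpha) + \val (coroot beta) :> g.
    by rewrite val_linearB val_linearZ addrC scaleNr.
  rewrite formPr mulrDr mulrCA !form_coroot // gE mulrBl.
  by rewrite mulrAC coroot_pair //; ring.
have gu : gamma u = 2.
  by rewrite gE /u !scalarB !scalarZ !coroot_root //; ring.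
have kuu : k_ u u = coroot_norm beta.
  by apply: (mulfI two_neq0_char0); rewrite ku gu.
have uE : u = coroot gamma by apply: coroot_unique => // s; rewrite ku kuu.
by split=> //; rewrite /coroot_norm -uE kuu.
Qed.

(** * The grading by rational numbers *)

Lemma sharp_eq alpha t : (forall s, alpha s = k_ s t) -> sharp kappa alpha = t.
Proof.
move=> at_; apply: xget_unique => // u au.
by apply: kform_inj => s; rewrite -au at_.
Qed.

Lemma sharp_zero alpha : alpha =1 \0 -> sharp kappa alpha = 0.
Proof. by move=> a0; apply: sharp_eq => s; rewrite a0 linear0 form0r. Qed.

Lemma sharp_integrable alpha : integrable_root alpha ->
  sharp kappa alpha = (2 / coroot_norm alpha) *: coroot alpha.
Proof.
move=> ia; apply: sharp_eq => s; rewrite val_linearZ formZr mulrAC.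
by rewrite form_coroot // mulfK ?coroot_norm_neq0.
Qed.

Lemma integrable_sharpE alpha s : integrable_root alpha ->
  alpha s = k_ s (sharp kappa alpha).
Proof.
move=> ia; rewrite sharp_integrable // val_linearZ formZr mulrAC.
by rewrite form_coroot // mulfK ?coroot_norm_neq0.
Qed.

Lemma rootspaces_independent D :
  independent D (fun alpha : {scalar h} => rootspace alpha : set g).
Proof.
move=> n i x inj_i ix sum0 k.
have := rootspace_filter [set i k] (fun j => (ix j).2) sum0.
rewrite (big_pred1 k) // => j /=; apply/asboolP/eqP => [/inj_i|->] //.
Qed.

Context (root_span : forall alpha, is_root alpha -> in_Zspan_integrable alpha).
Context (lambda : {scalar h}).

Lemma Zspan_sharp alpha n (c : 'I_n -> int) (b : 'I_n -> {scalar h}) :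
  (forall k, integrable_root (b k)) ->
  (forall t, alpha t = \sum_k b k t *~ c k) ->
  sharp kappa alpha = \sum_k (c k)%:~R *: sharp kappa (b k).
Proof.
move=> ib aE; apply: sharp_eq => s.
rewrite raddf_sum /= form_sumr aE; apply: eq_bigr => k _.
by rewrite val_linearZ formZr mulrzl (integrable_sharpE s (ib k)).
Qed.

Lemma weight_sharpE alpha s : weight alpha -> alpha s = k_ s (sharp kappa alpha).
Proof.
move=> [/root_span[n [c [b [ib aE]]]]|a0]; last first.
  by rewrite sharp_zero // a0 linear0 form0r.
rewrite (Zspan_sharp ib aE) aE raddf_sum /= form_sumr; apply: eq_bigr => k _.
by rewrite val_linearZ formZr mulrzl (integrable_sharpE s (ib k)).
Qed.

(** Additivity of the sharp map: a subgroup P of K containing lambda(beta#) for all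
    integrable roots beta contains it for all roots. It is used for the rational
    numbers and for a cyclic group of rational numbers. *)
Lemma weight_index_ind (P : set K) :
  P 0 -> (forall c d : K, P c -> P d -> P (c - d)) ->
  (forall beta, integrable_root beta -> P (lambda (sharp kappa beta))) ->
  forall alpha, weight alpha -> P (lambda (sharp kappa alpha)).
Proof.
move=> P0 PB Pi.
have PN (c : K) : P c -> P (- c) by rewrite -sub0r; exact: PB.
have PD (c d : K) : P c -> P d -> P (c + d).
  by rewrite -[d in c + d]opprK => ? /PN; exact: PB.
have Pz (c : K) (m : int) : P c -> P (c *~ m).
  move=> Pc; have Pn n : P (c *+ n).
    by elim: n => [|n IH]; rewrite ?mulr0n // mulrS; exact: PD.
  by case: m => n; [exact: Pn|rewrite NegzE mulrNz; exact/PN/Pn].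
move=> alpha [/root_span[n [c [b [ib aE]]]]|a0].
  rewrite (Zspan_sharp ib aE) linear_sum.
  by elim/big_ind: _ => // k _; rewrite linearZ /= mulrzl; exact/Pz/Pi.
by rewrite sharp_zero // linear0.
Qed.

Lemma grade_submod q : submod_closed [in (grade kappa lambda q : set g)].
Proof. by apply: sum_of_submod => alpha c x; exact: rootspaceZ. Qed.

Lemma grade_lie p q x y : grade kappa lambda p x -> grade kappa lambda q y ->
  grade kappa lambda (p + q) [lie x, y].
Proof.
move=> [n [i [u [iu ->]]]] [m [j [v [jv ->]]]].
rewrite lie_suml; apply: sum_of_sum => k; rewrite linear_sum.
apply: sum_of_sum => l; have [[[wi li] ui] [[wj lj] vj]] := (iu k, jv l).
(* If the bracket is zero, then i k + j l may fail to be a weight. *)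
have [uv0|uv0] := eqVneq [lie u k, v l] 0; first by rewrite /= uv0; exact: sum_of0.
have [|gamma gE] := @exists_scalar (fun s => i k s + j l s).
  by move=> c s t; rewrite !linearP /=; ring.
have uvg : rootspace gamma [lie u k, v l].
  by apply: rootspace_eq (rootspace_lie ui vj) => s; rewrite gE.
apply: (sum_of_term (i := gamma)) => //; split; first exact: rootspace_weight uvg uv0.
rewrite (@sharp_eq gamma (sharp kappa (i k) + sharp kappa (j l))).
  by rewrite scalarD li lj ratrD_char0.
move=> s; rewrite gE (weight_sharpE s wi) (weight_sharpE s wj).
by rewrite -[sharp kappa (i k)]scale1r val_linearP formPr mul1r scale1r.
Qed.

(** The decompositions of all the x_k into root vectors are put together in one
    family; the terms whose index is q_(k0) are those of x_(k0). *)
Lemma grades_independent : independent setT (grade kappa lambda : rat -> set g).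
Proof.
move=> n q x inj_q xq sum0 k0.
pose T := {m : nat & (('I_m -> {scalar h}) * ('I_m -> g))%type}.
have [|f fP] := @choice _ T (fun k (w : T) =>
    (forall l, grade_index kappa lambda (q k) ((tagged w).1 l) /\
       rootspace ((tagged w).1 l) ((tagged w).2 l)) /\
    x k = \sum_l (tagged w).2 l).
  by move=> k; have [_ [m [i [y yP]]]] := xq k; exists (existT _ m (i, y)).
pose J k := 'I_(tag (f k)) : finType.
pose a (p : {k : 'I_n & J k}) := (tagged (f (tag p))).1 (tagged p).
pose y (p : {k : 'I_n & J k}) := (tagged (f (tag p))).2 (tagged p).
have ya p : rootspace (a p) (y p) by exact: ((fP (tag p)).1 (tagged p)).2.
have aq p : lambda (sharp kappa (a p)) = ratr (q (tag p)).
  exact: ((fP (tag p)).1 (tagged p)).1.2.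
have sum_y (P : pred 'I_n) : \sum_(k | P k) x k = \sum_(p | P (tag p)) y p.
  under eq_bigr => k _ do rewrite (fP k).2.
  rewrite (@sig_big_dep _ _ _ _ J P (fun _ => predT) (fun k l => (tagged (f k)).2 l)).
  by apply: eq_bigl => p; rewrite andbT.
have := sum_y predT; rewrite sum0 => /esym sumy0.
have := rootspace_filter [set b | lambda (sharp kappa b) = ratr (q k0)] ya sumy0.
have := sum_y (pred1 k0); rewrite big_pred1_eq => ->.
apply: etrans; apply: eq_bigl => p /=; rewrite aq; apply/eqP/asboolP => [->//|].
by move=> /(ratr_inj_char0 charK)/inj_q.
Qed.

Lemma grade_sum (q_of : {scalar h} -> rat) :
  (forall alpha, weight alpha -> lambda (sharp kappa alpha) = ratr (q_of alpha)) ->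
  sum_of setT (grade kappa lambda) = setT :> set g.
Proof.
move=> qP; apply/seteqP; split=> // x _.
have [n [i [y [iy ->]]]] := weight_decomposition x.
apply: sum_of_sum => k; have [wi yi] := iy k.
apply: (sum_of_term (i := q_of (i k))) => //.
by apply: (sum_of_term (i := i k)) => //; split=> //; exact: qP.
Qed.

Context (kappa_rat : forall alpha, integrable_root alpha ->
  exists q : rat, coroot_norm alpha = ratr q).
Context (lambdaP : integral_weight lambda).

Lemma weight_index_rat alpha : weight alpha ->
  exists q : rat, lambda (sharp kappa alpha) = ratr q.
Proof.
pose P := [set x : K | exists q : rat, x = ratr q].
apply: (@weight_index_ind P).
- by exists 0; rewrite (ratr_int K 0).
- move=> _ _ [p ->] [q ->]; exists (p - q).
  by apply: (addIr (ratr q)); rewrite -ratrD_char0 // !subrK.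
- move=> beta ib; have [[q qE] [m mE]] := (kappa_rat ib, lambdaP ib).
  exists (2%:~R / q * m%:~R); rewrite sharp_integrable // scalarZ qE mE.
  by rewrite !ratrM_char0 // ratrV_char0 // !ratr_int.
Qed.

Lemma grade_is_grading : is_grading (grade kappa lambda : rat -> set g).
Proof.
split.
- exact: grade_submod.
- exact: grades_independent.
- have [|q_of qP] := @choice _ _ (fun (alpha : {scalar h}) q =>
      weight alpha -> lambda (sharp kappa alpha) = ratr q).
    move=> alpha; have [/weight_index_rat[q qE]|na] := pselect (weight alpha).
      by exists q.
    by exists 0.
  exact: grade_sum qP.
- exact: grade_lie.
Qed.

Lemma grade_neq0 q x : grade kappa lambda q x -> x != 0 ->
  exists2 alpha, weight alpha & lambda (sharp kappa alpha) = ratr q.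
Proof.
move=> [[|n] [i [y [iy ->]]]]; first by rewrite big_ord0 eqxx.
by have [[? ?] _] := iy ord0; exists (i ord0).
Qed.

Lemma rescaled_grading (d : rat) : d != 0 ->
  (forall q, (exists x : g, grade kappa lambda q x /\ x != 0) ->
     exists m : int, q = d *~ m) ->
  is_grading (fun m : int => grade kappa lambda (d *~ m) : set g).
Proof.
move=> d0 supp; have [Gsub Gind Gsum Glie] := grade_is_grading.
have inj_d : injective (fun m : int => d *~ m).
  by move=> m n /eqP; rewrite -mulrzr -[_ *~ n]mulrzr (inj_eq (mulfI d0)) => /eqP/intr_inj.
split=> //.
- move=> n i x inj_i xi; apply: (Gind n (fun k => d *~ i k)).
    by move=> j k /inj_d/inj_i.
  by move=> k; split=> //; case: (xi k).
- apply/seteqP; split=> // x _.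
  have : sum_of setT (grade kappa lambda) x by rewrite Gsum.
  move=> [n [q [y [yq ->]]]]; apply: sum_of_sum => k.
  have [->|y0] := eqVneq (y k) 0; first exact: sum_of0.
  have [|m qE] := supp (q k); first by exists (y k); case: (yq k).
  by apply: (sum_of_term (i := m)) => //; rewrite -qE; case: (yq k).
- by move=> m n x y xm yn; rewrite mulrzDr; exact: Glie.
Qed.

(** * The cyclic support *)

Section Cyclic.
Context (bound4 : forall alpha beta, integrable_root alpha -> integrable_root beta ->
  exists q : rat, beta (coroot alpha) * alpha (coroot beta) = ratr q /\ q <= 4).

(** The bound is applied to alpha and its reflection gamma in beta: gamma(alpha^)
    and alpha(gamma^) are both 2 - a b. So the one-sided bound also yields the
    sign of a b. *)
Lemma coroot_pair_bound alpha beta (a b : int) :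
  integrable_root alpha -> integrable_root beta ->
  beta (coroot alpha) = a%:~R -> alpha (coroot beta) = b%:~R ->
  0 <= a * b <= 4.
Proof.
move=> ia ib aE bE.
have [gamma [ig gE]] := reflection_integrable ib ia.
have [cgE _] := coroot_reflection ib ia ig gE.
have [q [qE q4]] := bound4 ia ig.
have prodE : ratr q = ((2 - a * b) ^+ 2)%:~R :> K.
  rewrite -qE gE cgE scalarB scalarZ !coroot_root // aE bE.
  by rewrite rmorphXn rmorphB rmorphM /=; ring.
have : q = ((2 - a * b) ^+ 2)%:~R by apply: (ratr_inj_char0 charK); rewrite ratr_int.
move=> qE'; move: q4; rewrite qE' (ler_int _ _ 4) => q4.
by nia.
Qed.

(** The quotient of the norms is a / b with a = beta(alpha^) and b = alpha(beta^),
    integers with 0 < a b <= 4; and each integer b with 1 <= |b| <= 4 divides 12. *)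
Lemma coroot_norm_ratio alpha beta :
  integrable_root alpha -> integrable_root beta -> beta (coroot alpha) != 0 ->
  exists r : int, coroot_norm alpha * 12%:~R = coroot_norm beta * r%:~R.
Proof.
move=> ia ib ba0.
have [a aE] := root_coroot_int ia ib.1; have [b bE] := root_coroot_int ib ia.1.
have /andP[ab0 ab4] := coroot_pair_bound ia ib aE bE.
have pairE := coroot_pair ia ib.
have a0 : a != 0 by rewrite -(intr_eq0_char0 charK) -aE.
have b0 : b != 0.
  apply: contra_neq ba0 => b0; apply: (mulIf (coroot_norm_neq0 ib)).
  by rewrite pairE bE b0 !mul0r.
have [b' b'E] : exists b' : int, b * b' = 12.
  have b4 : -4 <= b <= 4 by nia.
  exists (12 %/ b)%Z; move: b {bE ab0 ab4} b0 b4.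
  by case=> [[|[|[|[|[|b]]]]]|[|[|[|[|b]]]]].
exists (b' * a); rewrite -b'E !rmorphM /= -bE -aE.
by rewrite mulrA [_ * alpha _]mulrC -pairE; ring.
Qed.

(** Induction along the chain. If gamma is linked to c_n but not to c_(n+1), its
    reflection in c_n is linked to c_(n+1), because c_n is; a reflection does not
    change the norm of the coroot. *)
Lemma connected_link alpha beta : integrable_root alpha ->
  integrable_connected alpha beta -> exists gamma,
    [/\ integrable_root gamma, coroot_norm gamma = coroot_norm alpha &
        beta (coroot gamma) != 0].
Proof.
move=> ia [n [c [c0 <- ic linked]]].
elim: n ic linked => [|n IH] ic linked.
  by exists alpha; split=> //; rewrite c0 coroot_root // two_neq0_char0.
have [||gamma [ig gN gc]] := IH.
- by move=> j jn; apply: ic; exact: ltnW.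
- by move=> j jn; apply: linked; exact: ltnW.
have [cg0|] := eqVneq (c n.+1 (coroot gamma)) 0; last by exists gamma.
have icn : integrable_root (c n) by exact: ic.
have [delta [id dE]] := reflection_integrable icn ig.
have [cdE dN] := coroot_reflection icn ig id dE.
exists delta; split=> //; first by rewrite dN.
rewrite cdE scalarB scalarZ cg0 sub0r oppr_eq0 mulf_neq0 //.
exact: linked.
Qed.

(** By [weight_index_ind], a common d for the integrable roots suffices; it is
    1 / (6 N(alpha)) for any integrable root alpha. *)
Lemma weight_index_cyclic : integrable_roots_connected h ->
  exists2 d : rat, d != 0 & forall alpha, weight alpha ->
    exists m : int, lambda (sharp kappa alpha) = ratr (d *~ m).
Proof.
move=> conn.
suff [d d0 dP] : exists2 d : rat, d != 0 & forall alpha, integrable_root alpha ->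
    exists m : int, lambda (sharp kappa alpha) = ratr (d *~ m).
  exists d => //; pose P := [set x : K | exists m : int, x = ratr (d *~ m)].
  apply: (@weight_index_ind P) => //.
    by exists 0; rewrite mulr0z (ratr_int K 0).
  move=> _ _ [m ->] [n ->]; exists (m - n).
  by apply: (addIr (ratr (d *~ n))); rewrite -ratrD_char0 // subrK -mulrzDr subrK.
have [[alpha ia]|ni] := pselect (exists alpha : {scalar h}, integrable_root alpha); last first.
  (* Without integrable roots, zero is the only index. *)
  by exists 1 => // alpha ia; case: ni; exists alpha.
have [q qE] := kappa_rat ia.
have q0 : q != 0 by rewrite -(ratr_eq0_char0 charK) -qE coroot_norm_neq0.
exists (6%:~R * q)^-1; first by rewrite invr_eq0 mulf_neq0.
move=> beta ib; have [gamma [ig gN bg]] := connected_link ia (conn _ _ ia ib).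
have [r rE] := coroot_norm_ratio ig ib bg; have [m mE] := lambdaP ib.
exists (r * m); rewrite sharp_integrable // scalarZ mE -[_^-1 *~ _]mulrzr.
rewrite ratrM_char0 // ratrV_char0 // ratrM_char0 // !ratr_int rmorphM -qE -gN /=.
have := coroot_norm_neq0 ib; have := coroot_norm_neq0 ig.
set Nb := coroot_norm beta in rE *; set Ng := coroot_norm gamma in rE *.
move=> Ng0 Nb0; have s0 : 6 != 0 :> K by rewrite (natr_eq0_char0 charK 6).
apply: (mulfI Nb0); rewrite mulrA mulrCA mulfV // mulr1.
apply: (mulfI (mulf_neq0 s0 Ng0)).
rewrite [RHS]mulrCA [X in Nb * X]mulrA mulfV ?mulf_neq0 // mul1r [RHS]mulrA -rE.
by ring.
Qed.

End Cyclic.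

End SplitQuadratic.

Theorem theorem1p8 (K : fieldType) (charK : [pchar K] =i pred0)
    (g : lieType K) (S : {pred g}) (h : subLmodType S) (kappa : {symmetric g})
    (split_gh : split_lie h) (kappaP : invariant_nondegenerate kappa)
    (kappa_rat : forall alpha : {scalar h}, integrable_root alpha ->
       exists q : rat,
         kappa (\val (coroot alpha)) (\val (coroot alpha)) = ratr q)
    (root_span : forall alpha : {scalar h},
       is_root alpha -> in_Zspan_integrable alpha)
    (lambda : {scalar h}) (lambdaP : integral_weight lambda) :
  ((forall q : rat, independent (grade_index kappa lambda q)
                      (fun alpha : {scalar h} => rootspace alpha)) /\
   is_grading (grade kappa lambda)) /\
  ((forall alpha beta : {scalar h},
      integrable_root alpha -> integrable_root beta ->
      exists q : rat,
        beta (coroot alpha) * alpha (coroot beta) = ratr q /\ q <= 4) ->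
   integrable_roots_connected h ->
   exists d : rat,
     [/\ d != 0,
         forall q : rat, (exists x : g, grade kappa lambda q x /\ x != 0) ->
           exists m : int, q = d *~ m &
         is_grading (fun m : int => grade kappa lambda (d *~ m))]).
Proof.
split.
  split; first by move=> q; exact: rootspaces_independent.
  exact: (grade_is_grading charK split_gh kappaP root_span kappa_rat lambdaP).
move=> bound4 conn.
have [d d0 dP] := weight_index_cyclic charK split_gh kappaP root_span
  kappa_rat lambdaP bound4 conn.
have supp q : (exists x : g, grade kappa lambda q x /\ x != 0) ->
    exists m : int, q = d *~ m.
  move=> [x [xq x0]]; have [alpha wa aq] := grade_neq0 xq x0.
  by have [m mE] := dP alpha wa; exists m; apply: (ratr_inj_char0 charK); rewrite -aq.
exists d; split=> //.
exact: (rescaled_grading charK split_gh kappaP root_span kappa_rat lambdaP d0 supp).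
Qed.
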